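(* Let $\mathcal{D}$ be a fixed distribution supported on $[0,1]$ (not depending on $n$ or $m$) with mean $\mu$ and variance $s^2$. Then for every $\epsilon>0$ there exists $n_0$ such that for all $n\ge n_0$, all $m$, every preference profile $\sigma$ on $n$ voters and $m$ alternatives, and every expected-welfare-maximizing rule $f$ for $\mathcal{D}$, $$\mathbb{E}[\mathrm{dist}(f(\sigma),\sigma)]\ge(1-\epsilon)\max_{j\in A}\mathbb{E}[\mathrm{dist}(j,\sigma)].$$ Furthermore, if $\mathcal{D}$ has a continuously differentiable CDF $F$ satisfying $\frac{dF}{dx}(x)>0$ for $x\in(0,1)$, then for every $\epsilon>0$ there exists $m_0$ such that the same conclusion holds for all $m\ge m_0$ and all $n$.
   Context: There are $n$ voters and $m$ alternatives $A=\{1,\dots,m\}$. A preference profile $\sigma$ consists of a ranking of $A$ for each voter. A (deterministic) voting rule maps each preference profile to an alternative. Given a distribution $\mathcal{D}$ and a profile $\sigma$, a random utility profile $u$ consistent with $\sigma$ is generated as follows: independently for each voter $i$, draw $m$ i.i.d. samples from $\mathcal{D}$ and assign them, from highest to lowest, to the alternatives in the order of voter $i$'s ranking. The social welfare of $j$ is $\mathrm{sw}(j,u)=\sum_i u_{ij}$; expectations are over this random $u$. The distortion of $j$ at $\sigma$ is $\mathrm{dist}(j,\sigma)=\mathrm{sw}(j,u)/\max_{k\in A}\mathrm{sw}(k,u)$. A rule is an expected-welfare-maximizing rule for $\mathcal{D}$ if for every profile $\sigma$ it selects an alternative maximizing $\mathbb{E}[\mathrm{sw}(j,u)]$ over $j\in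 A$. *)

(* Defs.v *)
From HB Require Import structures.
From mathcomp Require Import all_boot all_order all_algebra all_fingroup.
From mathcomp Require Import all_classical all_reals all_analysis.
Set Implicit Arguments. Unset Strict Implicit. Unset Printing Implicit Defensive.
Import Order.TTheory GRing.Theory Num.Theory.
Import numFieldNormedType.Exports.
Local Open Scope ring_scope.

(* A preference profile on n voters and m alternatives: for each voter i,
   a ranking given as a permutation; (sigma i) k is the alternative that
   voter i ranks at position k (position 0 = most preferred). *)
Definition profile (n m : nat) := 'I_n -> {perm 'I_m}.

Section Model.
Variable R : realType.
Variable D : probability R R.

(* Expectation of g(X_0,...,X_{N-1}) for X_0..X_{N-1} i.i.d. ~ D, written
   as the iterated (Fubini) integral against N copies of D. *)
Fixpoint iid_exp (N : nat) (g : seq R -> R) : R :=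
  match N with
  | 0 => g [::]
  | N'.+1 => Rintegral D setT (fun x => iid_exp N' (fun s => g (x :: s)))
  end.

Definition sample (n m : nat) (s : seq R) (i : 'I_n) (k : 'I_m) : R :=
  nth 0 s (i * m + k).

(* Utility profile consistent with sigma: voter i's samples, sorted from
   highest to lowest, are assigned to alternatives in ranking order, so the
   alternative at position k gets the k-th largest sample. *)
Definition utility (n m : nat) (sigma : profile n m) (s : seq R)
  (i : 'I_n) (j : 'I_m) : R :=
  nth 0 (sort (fun x y : R => y <= x) [seq sample s i k | k <- enum 'I_m])
        ((sigma i)^-1%g j).

Definition sw (n m : nat) (sigma : profile n m) (s : seq R) (j : 'I_m) : R :=
  \sum_(i < n) utility sigma s i j.

(* distortion of j: sw(j,u) / max_k sw(k,u)  (with the convention x/0 = 0) *)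
Definition distortion (n m : nat) (sigma : profile n m) (s : seq R)
  (j : 'I_m) : R :=
  sw sigma s j / \big[Num.max/0]_(k < m) sw sigma s k.

Definition exp_sw (n m : nat) (sigma : profile n m) (j : 'I_m) : R :=
  iid_exp (n * m) (fun s => sw sigma s j).

Definition exp_dist (n m : nat) (sigma : profile n m) (j : 'I_m) : R :=
  iid_exp (n * m) (fun s => distortion sigma s j).

Definition ewm_rule (n m : nat) (f : profile n m -> 'I_m) : Prop :=
  forall (sigma : profile n m) (j : 'I_m), exp_sw sigma j <= exp_sw sigma (f sigma).

Definition good_approx (eps : R) (n m : nat) (f : profile n m -> 'I_m)
  (sigma : profile n m) : Prop :=
  (1 - eps) * \big[Num.max/0]_(j < m) exp_dist sigma j <= exp_dist sigma (f sigma).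

End Model.

Definition dist_cdf (R : realType) (D : probability R R) (x : R) : R :=
  fine (D `]-oo, x]%classic).

(* Main.v *)
(** Let W = max_k sw(k, u) and w = E[W]; then w >= n mu, because the expected
    welfares of the alternatives average to n mu. If E|W - w| <= n d, then for
    every alternative j, E[dist(j)] is within d / mu of E[sw(j)] / w, so
    maximizing the expected welfare maximizes the expected distortion up to an
    additive 2 d / mu, while the optimum is at least mu - d / mu.

    For many voters, replacing the utilities of one voter changes W by at most
    1, so Var W <= n whatever m is, and d is of order n^(-1/2).

    For many alternatives, F is strictly increasing on [0, 1], so by the mean
    value theorem each cell of the grid {i/L} has positive probability. If the
    empirical tails of two samples of size m are accurate on the grid, their
    order statistics of equal rank differ by at most 2/L; Chebyshev's
    inequality makes this hold for most voters, uniformly in n. *)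

Require Import Defs.
From HB Require Import structures.
From mathcomp Require Import all_boot all_order all_algebra all_fingroup.
From mathcomp Require Import all_classical all_reals all_analysis.
From mathcomp Require Import measurable_realfun ring lra zify.
Import Order.TTheory GRing.Theory Num.Theory.
Import numFieldNormedType.Exports.
Local Open Scope ring_scope.

Set Implicit Arguments.
Unset Strict Implicit.
Unset Printing Implicit Defensive.

(** * Measurability of functions of finitely many samples *)

Section SampleMeasurability.
Variable R : realType.
Implicit Types (g h : seq R -> R) (N : nat).

(* Joint measurability in the first [N] samples, tested on arbitrary measurable
   families so that no product sigma-algebra on N-tuples is needed. *)
Definition seq_measurable N g : Prop :=
  forall d (T : measurableType d) (X : nat -> T -> R),
    (forall i, measurable_fun setT (X i)) ->
    measurable_fun setT (fun t => g (mkseq (X^~ t) N)).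

Lemma eq_seq_measurable N g h :
  (forall s, size s = N -> g s = h s) -> seq_measurable N g -> seq_measurable N h.
Proof.
move=> gh mg d T X mX; apply: eq_measurable_fun (mg d T X mX) => t _ /=.
by rewrite gh // size_mkseq.
Qed.

Lemma seq_measurable_cst N a : seq_measurable N (fun=> a).
Proof. by move=> d T X mX; exact: measurable_cst. Qed.

Lemma seq_measurableD N g h :
  seq_measurable N g -> seq_measurable N h ->
  seq_measurable N (fun s => g s + h s).
Proof.
by move=> mg mh d T X mX; apply: measurable_funD; [exact: mg|exact: mh].
Qed.

Lemma seq_measurableM N g h :
  seq_measurable N g -> seq_measurable N h ->
  seq_measurable N (fun s => g s * h s).
Proof.
by move=> mg mh d T X mX; apply: measurable_funM; [exact: mg|exact: mh].
Qed.

Lemma seq_measurableB N g h :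
  seq_measurable N g -> seq_measurable N h ->
  seq_measurable N (fun s => g s - h s).
Proof.
by move=> mg mh d T X mX; apply: measurable_funB; [exact: mg|exact: mh].
Qed.

Lemma seq_measurable_norm N g :
  seq_measurable N g -> seq_measurable N (fun s => `|g s|).
Proof.
by move=> mg d T X mX; apply: measurableT_comp; [exact: normr_measurable|exact: mg].
Qed.

Lemma seq_measurable_sum N I (r : seq I) (F : I -> seq R -> R) :
  (forall i, seq_measurable N (F i)) -> seq_measurable N (fun s => \sum_(i <- r) F i s).
Proof. by move=> mF d T X mX; apply: measurable_sum => i; exact: mF. Qed.

Lemma seq_measurable_bigmax N I (r : seq I) (F : I -> seq R -> R) :
  (forall i, seq_measurable N (F i)) -> seq_measurable N (fun s => \big[Num.max/0]_(i <- r) F i s).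
Proof.
move=> mF; elim: r => [|i r IH].
  by apply: eq_seq_measurable (seq_measurable_cst N 0) => s _; rewrite big_nil.
apply: (@eq_seq_measurable N (fun s => Num.max (F i s) (\big[Num.max/0]_(i <- r) F i s))).
  by move=> s _; rewrite big_cons.
by move=> d T X mX; exact: measurable_maxr (mF i _ _ _ mX) (IH _ _ _ mX).
Qed.

(** On nonnegative reals, inversion with the convention 1/0 = 0 coincides with the power -1, which
    is measurable on the whole line. *)
Lemma seq_measurable_div N g h :
  (forall s, 0 <= h s) -> seq_measurable N g -> seq_measurable N h ->
  seq_measurable N (fun s => g s / h s).
Proof.
move=> h0 mg mh.
apply: (@eq_seq_measurable N (fun s => g s * (h s `^ (-1)))).
  by move=> s _; rewrite powR_inv1.
apply: seq_measurableM => // d T X mX.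
exact: measurableT_comp (measurable_powR (-1)) (mh _ _ _ mX).
Qed.

Lemma take_drop_mkseq a b N (f : nat -> R) : (a + b <= N)%N ->
  take b (drop a (mkseq f N)) = mkseq (fun i => f (a + i)%N) b.
Proof.
move=> abN; apply: (@eq_from_nth _ 0).
  rewrite size_mkseq size_take size_drop size_mkseq.
  by case: ltngtP => // ; lia.
move=> i; rewrite size_take size_drop size_mkseq => ib.
have {}ib : (i < b)%N by move: ib; case: ifP => //; lia.
by rewrite nth_take // nth_drop !nth_mkseq //; lia.
Qed.

Lemma seq_measurable_take_drop a b N g : (a + b <= N)%N -> seq_measurable b g ->
  seq_measurable N (fun s => g (take b (drop a s))).
Proof.
move=> abN mg d T X mX.
under eq_fun do rewrite take_drop_mkseq //.
exact: (mg d T (fun i => X (a + i)%N)).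
Qed.

Lemma mkseq_cat (f g : nat -> R) a N :
  mkseq f a ++ mkseq g N = mkseq (fun i => if (i < a)%N then f i else g (i - a)%N) (a + N).
Proof.
apply: (@eq_from_nth _ 0) => [|i]; first by rewrite size_cat !size_mkseq.
rewrite size_cat !size_mkseq => iaN; rewrite nth_cat !size_mkseq [RHS]nth_mkseq //.
by case: ltnP => ia; rewrite nth_mkseq //; lia.
Qed.

(** Fixing leading samples amounts to testing [g] on a family whose first [size u] members are
    constant functions. *)
Lemma seq_measurable_cat u N g :
  seq_measurable (size u + N) g -> seq_measurable N (fun s => g (u ++ s)).
Proof.
move=> mg d T X mX.
have -> : (fun t => g (u ++ mkseq (X^~ t) N)) =
  (fun t => g (mkseq (fun i => (if (i < size u)%N then cst (nth 0 u i) else X (i - size u)%N) t)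
                     (size u + N))).
  apply/funext => t; congr g; rewrite -{1}(mkseq_nth 0 u) mkseq_cat.
  by apply: eq_mkseq => i; case: ifP.
by apply: mg => i; case: ifP.
Qed.

End SampleMeasurability.

(** * Calculus of the iterated expectation on bounded functions, and a variance bound *)

Section Expectation.
Variables (R : realType) (D : probability R R).
Implicit Types (g h : seq R -> R) (F : R -> R) (a b N n : nat) (x M c : R) (s u : seq R).
Local Notation E := (iid_exp D).

Lemma eq_iid_exp N g h : (forall s, size s = N -> g s = h s) -> E N g = E N h.
Proof.
elim: N g h => [|N IH] g h gh /=; first exact: gh.
by apply: eq_Rintegral => x _; apply: IH => s sN; apply: gh; rewrite /= sN.
Qed.

Lemma iid_exp_cat a b g :
  E (a + b) g = E a (fun s => E b (fun t => g (s ++ t))).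
Proof. by elim: a g => //= a IH g; apply: eq_Rintegral => x _; rewrite IH. Qed.

(** Tonelli applies to the positive and the negative part separately, so no integrability of [F] is
    required. *)
Lemma measurable_Rintegral_snd d (T : measurableType d) (F : T * R -> R) :
  measurable_fun setT F -> measurable_fun setT (fun t => Rintegral D setT (fun x => F (t, x))).
Proof.
move=> mF; rewrite /Rintegral.
apply: (measurableT_comp (fine_measurable measurableT)).
under eq_fun do rewrite integralE.
have mEF : measurable_fun setT (EFin \o F) by exact/measurable_EFinP.
apply: emeasurable_funB.
  have mp := @measurable_fun_fubini_tonelli_F _ _ _ _ _ D (EFin \o F)^\+%E.
  apply: eq_measurable_fun (mp (measurable_funepos mEF) _) => [t _|z] //.
  by apply: eq_integral => x _; rewrite !funeposE.
have mn := @measurable_fun_fubini_tonelli_F _ _ _ _ _ D (EFin \o F)^\-%E.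
apply: eq_measurable_fun (mn (measurable_funeneg mEF) _) => [t _|z] //.
by apply: eq_integral => x _; rewrite !funenegE.
Qed.

Lemma seq_measurable_iid_exp a N g : seq_measurable (a + N) g ->
  seq_measurable a (fun s => E N (fun t => g (s ++ t))).
Proof.
elim: N a => [|N IH] a mg.
  by rewrite addn0 in mg; apply: eq_seq_measurable mg => s _ /=; rewrite cats0.
rewrite addnS -addSn in mg; have mh := IH _ mg.
move=> d T X mX /=.
set h := fun s => _ in mh.
(* The sample integrated next becomes a coordinate of the test space [T * R]; this is why
   [seq_measurable] quantifies over all spaces. *)
pose H (z : T * R) := h (mkseq (fun i => if (i < a)%N then X i z.1 else z.2) a.+1).
have -> : (fun t => Rintegral D setT (fun x =>
    E N (fun s => g (mkseq (X^~ t) a ++ x :: s)))) =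
  (fun t => Rintegral D setT (fun x => H (t, x))).
  apply/funext => t; apply: eq_Rintegral => x _.
  rewrite /H /h; apply: eq_iid_exp => s _.
  rewrite -[in RHS]addn1 -(mkseq_cat (X^~ t) (fun _ => x) a 1) -catA.
  by rewrite /mkseq /=.
apply: (@measurable_Rintegral_snd _ _ H).
apply: (mh _ _ (fun i (z : T * R) => if (i < a)%N then X i z.1 else z.2)) => i.
case: (i < a)%N; last exact: measurable_snd.
exact: measurableT_comp (mX i) measurable_fst.
Qed.

Lemma seq_measurable1_cons N g :
  seq_measurable N.+1 g ->
  measurable_fun setT (fun x : R => E N (fun s => g (x :: s))).
Proof.
move=> mg; have := @seq_measurable_iid_exp 1 N g mg _ _ (fun _ x => x : R); apply => i.
exact: measurable_id.
Qed.

Hypothesis D01 : D `[0, 1]%classic = 1%E.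

Let I01 := `[0, 1]%classic : set R.
Let mI01 : measurable I01. Proof. exact: measurable_itv. Qed.
Let D01C : D (~` I01)%classic = 0%E.
Proof. by rewrite probability_setC // D01 subee. Qed.

Lemma Rintegral_unit_itv (F : R -> R) : measurable_fun setT F ->
  Rintegral D setT F = Rintegral D `[0, 1] F.
Proof.
move=> mF; rewrite [RHS]Rintegral_mkcond; congr fine.
apply: ae_eq_integral => //.
- exact/measurable_EFinP.
- apply/measurable_EFinP; apply/measurable_restrict => //.
  by rewrite setTI; exact: measurable_funS mF.
exists (~` I01)%classic; split => //; first exact: measurableC.
by move=> x /= nx ix; apply: nx => _; rewrite patchE mem_set.
Qed.

Definition unit_seq (s : seq R) := all (fun x => 0 <= x <= 1) s.

Lemma unit_seq_cat s u : unit_seq (s ++ u) = unit_seq s && unit_seq u.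
Proof. exact: all_cat. Qed.

(** Bounds are asked only where [D] lives, on samples in [0, 1]; measurability is global because
    [iid_exp] integrates over the whole line. *)
Definition admissible N g : Prop :=
  seq_measurable N g /\ exists M, forall s, size s = N -> unit_seq s -> `|g s| <= M.

Lemma bounded_integrable (F : R -> R) (M : R) : measurable_fun setT F ->
  (forall x : R, 0 <= x <= 1 -> `|F x| <= M) -> D.-integrable `[0, 1]%classic (EFin \o F).
Proof.
move=> mF bF; apply: measurable_bounded_integrable => //.
- by apply: le_lt_trans (ltry 1); exact: probability_le1.
- exact: measurable_funS mF.
exists M; split; first exact: num_real.
move=> y My x /=; rewrite in_itv /= => x01.
by apply: le_trans (ltW My); exact: bF.
Qed.


Lemma admissible_cons N g x :
  0 <= x <= 1 -> admissible N.+1 g -> admissible N (fun s => g (x :: s)).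
Proof.
move=> x01 [mg [M bg]]; split; first exact: (@seq_measurable_cat _ [:: x] N g).
by exists M => s sN us; apply: bg; rewrite /= ?sN ?x01.
Qed.

(** Bounds and monotonicity go through one induction: comparing the outer integrals needs integrable
    inner expectations, and the inductive bounds supply this. *)
Lemma iid_exp_le_norm N g h M : seq_measurable N g -> seq_measurable N h ->
  (forall s, size s = N -> unit_seq s -> `|g s| <= M) ->
  (forall s, size s = N -> unit_seq s -> `|h s| <= M) ->
  (forall s, size s = N -> unit_seq s -> g s <= h s) ->
  [/\ `|E N g| <= M, `|E N h| <= M & E N g <= E N h].
Proof.
elim: N g h => [|N IH] g h mg mh bg bh gh.
  by split; [exact: bg|exact: bh|exact: gh].
have HIH (x : R) : 0 <= x <= 1 -> [/\ `|E N (fun s => g (x :: s))| <= M,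
    `|E N (fun s => h (x :: s))| <= M &
    E N (fun s => g (x :: s)) <= E N (fun s => h (x :: s))].
  move=> x01; apply: IH; [exact: (@seq_measurable_cat _ [:: x] N g)|exact: (@seq_measurable_cat _ [:: x] N h)|..];
    by move=> s sN us; (apply: bg || apply: bh || apply: gh); rewrite /= ?sN ?x01.
have mG := seq_measurable1_cons mg; have mH := seq_measurable1_cons mh.
have iG : D.-integrable `[0, 1]%classic (EFin \o (fun x : R => E N (fun s => g (x :: s)))).
  by apply: (@bounded_integrable _ M) => // x /HIH[].
have iH : D.-integrable `[0, 1]%classic (EFin \o (fun x : R => E N (fun s => h (x :: s)))).
  by apply: (@bounded_integrable _ M) => // x /HIH[].
have ic c : D.-integrable `[0, 1]%classic (EFin \o (cst c)).
  by apply: (@bounded_integrable (cst c) `|c|).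
have Ic c : Rintegral D `[0, 1] (cst c) = c.
  by rewrite Rintegral_cst // -[RHS]mulr1; congr (_ * _); exact: (congr1 fine D01).
rewrite /= !Rintegral_unit_itv //.
have key F : D.-integrable `[0, 1]%classic (EFin \o F) ->
    (forall x, 0 <= x <= 1 -> `|F x| <= M) -> `|Rintegral D `[0, 1] F| <= M.
  move=> iF bF; rewrite ler_norml -{1}(Ic (- M)) -{2}(Ic M); apply/andP; split;
  [apply: (le_Rintegral _ (ic (- M)) iF) => // x|apply: (le_Rintegral _ iF (ic M)) => // x];
  by rewrite /= in_itv /= => /bF; rewrite ler_norml => /andP[].
split; [by apply: key => // x /HIH[]|by apply: key => // x /HIH[]|].
by apply: le_Rintegral => // x; rewrite /= in_itv /= => /HIH[].
Qed.

Lemma admissible_cst N c : admissible N (fun=> c).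
Proof. by split; [exact: seq_measurable_cst|exists `|c|]. Qed.

Lemma admissibleD N g h :
  admissible N g -> admissible N h -> admissible N (fun s => g s + h s).
Proof.
move=> [mg [M bg]] [mh [M' bh]]; split; first exact: seq_measurableD.
by exists (M + M') => s sN us; rewrite (le_trans (ler_normD _ _))// lerD ?bg ?bh.
Qed.

Lemma admissibleM N g h :
  admissible N g -> admissible N h -> admissible N (fun s => g s * h s).
Proof.
move=> [mg [M bg]] [mh [M' bh]]; split; first exact: seq_measurableM.
by exists (M * M') => s sN us; rewrite normrM ler_pM ?bg ?bh.
Qed.

Lemma admissibleB N g h :
  admissible N g -> admissible N h -> admissible N (fun s => g s - h s).
Proof.
move=> [mg [M bg]] [mh [M' bh]]; split; first exact: seq_measurableB.
by exists (M + M') => s sN us; rewrite (le_trans (ler_normB _ _))// lerD ?bg ?bh.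
Qed.

Lemma admissible_sqr_sub N g c :
  admissible N g -> admissible N (fun s => (g s - c) ^+ 2).
Proof.
move=> ag; under eq_fun do rewrite expr2.
by apply: admissibleM; apply: admissibleB => //; exact: admissible_cst.
Qed.

Lemma admissible_norm N g : admissible N g -> admissible N (fun s => `|g s|).
Proof.
move=> [mg [M bg]]; split; first exact: seq_measurable_norm.
by exists M => s sN us; rewrite normr_id bg.
Qed.

Lemma admissible_sum N I (r : seq I) (F : I -> seq R -> R) :
  (forall i, admissible N (F i)) -> admissible N (fun s => \sum_(i <- r) F i s).
Proof.
move=> aF; split; first by apply: seq_measurable_sum => i; case: (aF i).
elim: r => [|i r [M IH]].
  by exists 0 => s _ _; rewrite big_nil normr0.
have [_ [M' bF]] := aF i; exists (M' + M) => s sN us.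
by rewrite big_cons (le_trans (ler_normD _ _))// lerD ?bF ?IH.
Qed.

Lemma admissible_take_drop a b N g : (a + b <= N)%N -> admissible b g ->
  admissible N (fun s => g (take b (drop a s))).
Proof.
move=> abN [mg [M bg]]; split; first exact: seq_measurable_take_drop.
exists M => s sN us; apply: bg.
  by rewrite size_takel // size_drop sN; lia.
by apply/allP => x /mem_take/mem_drop; exact: (allP us).
Qed.

Lemma iid_exp_le N g h : admissible N g -> admissible N h ->
  (forall s, size s = N -> unit_seq s -> g s <= h s) -> E N g <= E N h.
Proof.
move=> [mg [M bg]] [mh [M' bh]] gh.
by have [||//] := @iid_exp_le_norm N g h (Num.max M M') mg mh _ _ gh;
  move=> s sN us; rewrite le_max ?bg ?bh ?orbT.
Qed.

Lemma admissible_iid_exp a N g :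
  admissible (a + N) g -> admissible a (fun s => E N (fun t => g (s ++ t))).
Proof.
move=> [mg [M bg]]; split; first exact: seq_measurable_iid_exp.
exists M => s sa us.
have mgs : seq_measurable N (fun t => g (s ++ t)) by apply: seq_measurable_cat; rewrite sa.
have bgs t : size t = N -> unit_seq t -> `|g (s ++ t)| <= M.
  by move=> tN ut; apply: bg; rewrite ?size_cat ?sa ?tN // unit_seq_cat us.
by have [] := iid_exp_le_norm mgs mgs bgs bgs (fun _ _ _ => lexx _).
Qed.

Lemma admissible_cat u N g :
  unit_seq u -> admissible (size u + N) g -> admissible N (fun s => g (u ++ s)).
Proof.
move=> uu [mg [M bg]]; split; first exact: seq_measurable_cat.
by exists M => t tN ut; apply: bg; rewrite ?size_cat ?tN // unit_seq_cat uu.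
Qed.

Lemma cons_integrable N g : admissible N.+1 g ->
  D.-integrable `[0, 1]%classic (EFin \o (fun x : R => E N (fun s => g (x :: s)))).
Proof.
move=> [mg [M bg]]; apply: (@bounded_integrable _ M); first exact: seq_measurable1_cons.
move=> x x01; have mgs := @seq_measurable_cat _ [:: x] N g mg.
have bgs s : size s = N -> unit_seq s -> `|g (x :: s)| <= M.
  by move=> sN us; apply: bg; rewrite /= ?sN ?x01.
by have [] := iid_exp_le_norm mgs mgs bgs bgs (fun _ _ _ => lexx _).
Qed.

Lemma iid_expD N g h : admissible N g -> admissible N h ->
  E N (fun s => g s + h s) = E N g + E N h.
Proof.
elim: N g h => [//|N IH] g h ag ah.
have [[mg _] [mh _] [mgh _]] := And3 ag ah (admissibleD ag ah).
rewrite /= !Rintegral_unit_itv; try exact: seq_measurable1_cons; last first.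
  exact: (seq_measurable1_cons mgh).
rewrite -RintegralD //; try exact: cons_integrable.
apply: eq_Rintegral => x; rewrite inE /= in_itv /= => x01.
by rewrite IH //; exact: admissible_cons.
Qed.

Lemma iid_expZ N c g : admissible N g -> E N (fun s => c * g s) = c * E N g.
Proof.
elim: N g => [//|N IH] g ag.
have [[mg _] [mag _]] := conj ag (admissibleM (admissible_cst N.+1 c) ag).
rewrite /= !Rintegral_unit_itv; try exact: seq_measurable1_cons; last exact: (seq_measurable1_cons mag).
rewrite -RintegralZl //; try exact: cons_integrable.
apply: eq_Rintegral => x; rewrite inE /= in_itv /= => x01.
by rewrite IH //; exact: admissible_cons.
Qed.

Lemma iid_exp_cst N c : E N (fun=> c) = c.
Proof.
elim: N => //= N ->.
rewrite Rintegral_cst // -[RHS]mulr1; congr (_ * _).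
exact: (congr1 fine (@probability_setT _ _ _ D)).
Qed.

Lemma iid_expB N g h : admissible N g -> admissible N h ->
  E N (fun s => g s - h s) = E N g - E N h.
Proof.
move=> ag ah; rewrite -mulN1r -iid_expZ // -iid_expD //; last first.
  exact: admissibleM (admissible_cst _ _) ah.
by apply: eq_iid_exp => s _; rewrite mulN1r.
Qed.

Lemma iid_exp_sum N I (r : seq I) (F : I -> seq R -> R) :
  (forall i, admissible N (F i)) -> E N (fun s => \sum_(i <- r) F i s) = \sum_(i <- r) E N (F i).
Proof.
move=> aF; elim: r => [|i r IH].
  by rewrite big_nil -[RHS](iid_exp_cst N); apply: eq_iid_exp => s _; rewrite big_nil.
rewrite big_cons -IH -iid_expD //; last exact: admissible_sum.
by apply: eq_iid_exp => s _; rewrite big_cons.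
Qed.

(** The samples before and after the block are integrated out against functions constant in them. *)
Lemma iid_exp_take_drop a b N g : (a + b <= N)%N ->
  E N (fun s => g (take b (drop a s))) = E b g.
Proof.
move=> abN; have -> : N = (a + (b + (N - (a + b))))%N by lia.
rewrite iid_exp_cat -[RHS](iid_exp_cst a); apply: eq_iid_exp => s sa.
rewrite iid_exp_cat; apply: eq_iid_exp => t tb.
rewrite -[RHS](iid_exp_cst (N - (a + b))); apply: eq_iid_exp => u _.
by rewrite drop_size_cat // take_size_cat.
Qed.

(* Efron-Stein, one block of [b] samples at a time: conditioning on the first
   block splits the variance as in the law of total variance. *)
Lemma iid_exp_variance_le n b g : admissible (n * b) g ->
  (forall p t t' q : seq R, (b %| size p)%N -> size t = b -> size t' = b ->
     size (p ++ t ++ q) = (n * b)%N -> unit_seq (p ++ t ++ q) -> unit_seq t' ->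
     `|g (p ++ t ++ q) - g (p ++ t' ++ q)| <= 1) ->
  E (n * b) (fun s => (g s - E (n * b) g) ^+ 2) <= n%:R.
Proof.
elim: n g => [|n IH] g ag Hg; first by rewrite mul0n /= subrr expr0n.
rewrite mulSn in ag Hg *.
(* [h] is the conditional expectation given the first block. Its values differ pairwise by at most
   1, hence each is within 1 of their mean [e]. *)
pose h t := E (n * b) (fun s => g (t ++ s)).
have ah : admissible b h by exact: admissible_iid_exp.
have agt t : size t = b -> unit_seq t -> admissible (n * b) (fun s => g (t ++ s)).
  by move=> tb ut; apply: admissible_cat => //; rewrite tb.
have hh t t' : size t = b -> unit_seq t -> size t' = b -> unit_seq t' -> h t - h t' <= 1.
  move=> tb ut t'b ut'; rewrite -iid_expB; try exact: agt.
  rewrite -(iid_exp_cst (n * b) 1); apply: iid_exp_le => [||s sN us].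
  - by apply: admissibleB; exact: agt.
  - exact: admissible_cst.
  apply: le_trans (ler_norm _) _; apply: (Hg [::]) => //.
    by rewrite /= size_cat tb sN.
  by rewrite /= unit_seq_cat ut.
set e := E (b + n * b) g; have eE : e = E b h by exact: iid_exp_cat.
rewrite iid_exp_cat.
have he t : size t = b -> unit_seq t -> `|h t - e| <= 1.
  move=> tb ut; rewrite eE -[X in X - _](iid_exp_cst b) -iid_expB //; last exact: admissible_cst.
  rewrite ler_norml -{1}(iid_exp_cst b (- 1)) -{2}(iid_exp_cst b 1).
  have aB : admissible b (fun s => h t - h s) by apply: admissibleB => //; exact: admissible_cst.
  apply/andP; split; apply: iid_exp_le => //; try exact: admissible_cst.
    by move=> s sb us; rewrite lerNl opprB hh.
  by move=> s sb us; rewrite hh.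
rewrite -(iid_exp_cst b n.+1%:R); apply: iid_exp_le => [||t tb ut].
- by apply: (@admissible_iid_exp _ _ (fun s => (g s - e) ^+ 2)); exact: admissible_sqr_sub.
- exact: admissible_cst.
have IHt := IH _ (agt t tb ut); rewrite -/(h t) in IHt.
have -> : E (n * b) (fun s => (g (t ++ s) - e) ^+ 2) =
    E (n * b) (fun s => (g (t ++ s) - h t) ^+ 2) + (h t - e) ^+ 2.
  (* The zero inserted here is the cross term: [h t - h t] is then read as the expectation of
     [g (t ++ s) - h t]. *)
  have -> : (h t - e) ^+ 2 = 2 * (h t - e) * (h t - h t) + (h t - e) ^+ 2 by ring.
  have a1 := agt t tb ut; have a2 := admissible_cst (n * b) (h t).
  rewrite {3}/h -[X in _ * (_ - X) + _](iid_exp_cst (n * b)) -iid_expB //.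
  rewrite -iid_expZ; last exact: admissibleB.
  rewrite -[in X in _ + (_ + X)](iid_exp_cst (n * b) ((h t - e) ^+ 2)).
  rewrite -iid_expD; [|exact: admissibleM (admissible_cst _ _) (admissibleB _ _)|exact: admissible_cst].
  rewrite -iid_expD; [|exact: admissible_sqr_sub|].
    by apply: eq_iid_exp => s _; ring.
  by apply: admissibleD (admissible_cst _ _); exact: admissibleM (admissible_cst _ _) (admissibleB _ _).
rewrite -natr1 lerD //.
  apply: IHt => p u u' q bp ub u'b sN us us'; rewrite !catA -!(catA (t ++ p)).
  apply: Hg => //; rewrite ?size_cat ?tb ?dvdn_addr //.
    by rewrite -sN !size_cat !addnA.
  by rewrite -catA unit_seq_cat ut.
by rewrite -[leRHS](expr1n _ 2) -(real_normK (num_real (h t - e))) lerXn2r ?nnegrE ?he.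
Qed.

End Expectation.

(** * Order statistics and their measurability *)

Section OrderStatistics.
Variables (R : realType) (D : probability R R).
Hypothesis D01 : D `[0, 1]%classic = 1%E.
Implicit Types (g h : seq R -> R) (F : R -> R) (N k : nat) (x M c r : R) (s : seq R).
Local Notation E := (iid_exp D).

Lemma admissible_nth N F M i : measurable_fun setT F ->
  (forall x, 0 <= x <= 1 -> `|F x| <= M) -> admissible N (fun s => F (nth 0 s i)).
Proof.
move=> mF bF; split=> [d T X mX|].
  have [iN|Ni] := ltnP i N.
    by under eq_fun do rewrite nth_mkseq //; exact: measurableT_comp.
  by under eq_fun do rewrite nth_default ?size_mkseq //; exact: measurable_cst.
exists M => s sN us; apply: bF.
have [iN|Ni] := ltnP i (size s); first exact: (all_nthP 0 us).
by rewrite nth_default // lexx ler01.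
Qed.

Lemma admissible_sum_seq N F M : measurable_fun setT F ->
  (forall x, 0 <= x <= 1 -> `|F x| <= M) -> admissible N (fun s => \sum_(x <- s) F x).
Proof.
move=> mF bF.
have [mS [M' bS]] := @admissible_sum R N _ (index_iota 0 N) (fun i s => F (nth 0 s i))
  (fun i => admissible_nth N i mF bF).
have S s : size s = N -> \sum_(i <- index_iota 0 N) F (nth 0 s i) = \sum_(x <- s) F x.
  by move=> <-; rewrite [RHS](big_nth 0).
split; first exact: eq_seq_measurable mS.
by exists M' => s sN us; rewrite -S // bS.
Qed.

Lemma iid_exp_sum_seq N F M : measurable_fun setT F ->
  (forall x, 0 <= x <= 1 -> `|F x| <= M) ->
  E N (fun s => \sum_(x <- s) F x) = N%:R * Rintegral D setT F.
Proof.
move=> mF bF.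
have -> : E N (fun s => \sum_(x <- s) F x) =
    E N (fun s => \sum_(i <- index_iota 0 N) F (nth 0 s i)).
  by apply: eq_iid_exp => s sN; rewrite (big_nth 0) sN.
rewrite (iid_exp_sum D01); last by move=> i; exact: admissible_nth mF bF.
rewrite (@eq_big_nat _ _ _ _ _ _ (fun=> Rintegral D setT F)).
  by rewrite sumr_const_nat subn0 mulr_natl.
move=> i /andP[_ iN].
rewrite -[RHS](@iid_exp_take_drop _ D i 1 N (fun s => F (nth 0 s 0))).
- by apply: eq_iid_exp => s sN; rewrite nth_take // nth_drop addn0.
- by rewrite addn1.
Qed.

Definition ord_stat k s : R := nth 0 (sort (fun x y : R => y <= x) s) k.

(** In decreasing order the entries above [r] form a prefix. This trades order statistics for
    counts, which are sums of independent indicators. *)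
Lemma ord_stat_gt k s r : (k < size s)%N ->
  (r < ord_stat k s) = (k < count (fun x => r < x)%R s)%N.
Proof.
move=> ks; set a := fun x : R => (r < x)%R.
rewrite /ord_stat; set s' := sort _ s.
have ks' : (k < size s')%N by rewrite size_sort.
have so : sorted (fun x y : R => y <= x) s'.
  by apply: sort_sorted => x y; exact: le_total.
have nthge i j : (i <= j < size s')%N -> nth 0 s' j <= nth 0 s' i.
  move=> /andP[ij js].
  apply: (sorted_leq_nth (leT := fun x y : R => y <= x)) => //.
  - by move=> y x z yx zy; exact: le_trans zy yx.
  - by rewrite inE (leq_ltn_trans ij).
rewrite -(count_sort (fun x y : R => y <= x)) -/s'.
rewrite -[in RHS](cat_take_drop k s') count_cat.
have [lt_r|le_r] := ltP r (nth 0 s' k).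
  have /eqP -> : count a (take k s') == k.
    rewrite -[X in _ == X](size_takel (ltnW ks')) -all_count.
    apply/(all_nthP 0) => i; rewrite size_takel ?(ltnW ks') // => ik.
    by rewrite nth_take // /a (lt_le_trans lt_r) // nthge // (ltnW ik).
  by rewrite (drop_nth 0) //= /a lt_r /= add1n addnS ltnS leq_addr.
have -> : count a (drop k s') = 0%N.
  apply/eqP; rewrite -leqn0 leqNgt -has_count; apply/(has_nthP 0) => -[i].
  rewrite size_drop => iks; rewrite nth_drop /a ltNge => /negP; apply.
  by apply: le_trans le_r; apply: nthge; rewrite leq_addr -ltn_subRL iks.
case: ltnP => //; rewrite addn0 => /leq_trans/(_ (count_size _ _)).
by rewrite size_take ks' ltnn.
Qed.

Lemma ord_stat_bounds k s : unit_seq s -> 0 <= ord_stat k s <= 1.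
Proof.
move=> us; rewrite /ord_stat; set s' := sort _ s.
have us' : unit_seq s' by rewrite /unit_seq all_sort.
have [ks|sk] := ltnP k (size s'); first exact: (all_nthP 0 us').
by rewrite nth_default // lexx ler01.
Qed.

Lemma measurable_gt_nat r : measurable_fun setT (fun x : R => (r < x)%R%:R : R).
Proof.
apply: nondecreasing_measurable => // x y xy; rewrite ler_nat.
by case: ltP => //= rx; rewrite (lt_le_trans rx).
Qed.

Lemma normr_bool_le1 (b : bool) : `|b%:R : R| <= 1.
Proof. by case: b; rewrite ?normr1 ?normr0. Qed.

Lemma count_sum (a : pred R) s : (count a s)%:R = \sum_(x <- s) (a x)%:R :> R.
Proof. by rewrite -sum1_count big_mkcond natr_sum; apply: eq_bigr => x _; case: (a x). Qed.

(** Open upper rays generate the Borel sets, and [ord_stat_gt] turns their preimages into conditions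
    on a measurable count. *)
Lemma admissible_ord_stat N k : admissible N (ord_stat k).
Proof.
split; last first.
  exists 1 => s _ us; rewrite ger0_norm; by case/andP: (ord_stat_bounds k us).
move=> d T X mX; have [kN|Nk] := ltnP k N; last first.
  under eq_fun do rewrite /ord_stat nth_default ?size_sort ?size_mkseq //.
  exact: measurable_cst.
apply: (measurability (@RGenOInfty.G R)) => [|/= _ [_] [r] -> <-].
  exact: RGenOInfty.measurableE.
rewrite setTI.
have [mc _] := admissible_sum_seq N (measurable_gt_nat r) (fun x _ => normr_bool_le1 (r < x)%R).
have := measurable_fun_ltr (measurable_cst (k%:R : R)) (mc _ _ _ mX).
move=> /(_ measurableT [set true]%classic I); rewrite setTI.
by congr measurable; apply/seteqP; split => t /=;
  rewrite in_itv /= andbT ord_stat_gt ?size_mkseq // -(ltr_nat R) count_sum.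
Qed.

End OrderStatistics.

(** * Welfare, distortion, and the reduction to concentration of the maximal welfare *)

Section Welfare.
Variables (R : realType) (D : probability R R) (n m : nat) (sigma : profile n m).
Hypothesis D01 : D `[0, 1]%classic = 1%E.
Implicit Types (i : 'I_n) (j : 'I_m) (s u : seq R).
Local Notation E := (iid_exp D).

Definition block (i : nat) s := take m (drop (i * m) s).

Definition max_sw s := \big[Num.max/0]_(k < m) sw sigma s k.

Lemma block_lt i : (i * m + m <= n * m)%N.
Proof. by rewrite addnC -mulSn leq_mul2r ltn_ord orbT. Qed.

Lemma size_block i s : size s = (n * m)%N -> size (block i s) = m.
Proof.
move=> sN; rewrite size_takel // size_drop sN leq_subRL ?block_lt //.
by rewrite (leq_trans _ (block_lt i)) ?leq_addr.
Qed.

Lemma unit_block (i : nat) s : unit_seq s -> unit_seq (block i s).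
Proof. by move=> us; apply/allP => x /mem_take/mem_drop; exact: (allP us). Qed.

Lemma utilityE s i j : size s = (n * m)%N ->
  utility sigma s i j = ord_stat ((sigma i)^-1%g j) (block i s).
Proof.
move=> sN; rewrite /utility /ord_stat; congr (nth 0 (sort _ _) _).
apply: (@eq_from_nth _ 0); first by rewrite size_map size_enum_ord size_block.
move=> k; rewrite size_map size_enum_ord => km.
rewrite (nth_map (Ordinal km)) ?size_enum_ord // /sample nth_enum_ord //.
by rewrite nth_take // nth_drop.
Qed.

Lemma utility_bounds s i j : size s = (n * m)%N -> unit_seq s ->
  0 <= utility sigma s i j <= 1.
Proof. by move=> sN us; rewrite utilityE // ord_stat_bounds // unit_block. Qed.

Lemma sw_bounds s j : size s = (n * m)%N -> unit_seq s ->
  0 <= sw sigma s j <= n%:R.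
Proof.
move=> sN us; have ub i := utility_bounds i j sN us.
rewrite sumr_ge0 /= => [|i _]; last by case/andP: (ub i).
rewrite -[leRHS](_ : \sum_(i < n) 1 = _); last by rewrite sumr_const card_ord.
by apply: ler_sum => i _; case/andP: (ub i).
Qed.

Lemma sw_le_max s j : sw sigma s j <= max_sw s.
Proof. by rewrite /max_sw (bigD1 j) //= le_max lexx. Qed.

Lemma max_sw_ge0 s : 0 <= max_sw s.
Proof. by rewrite /max_sw; elim/big_rec: _ => // j x _ x0; rewrite le_max x0 orbT. Qed.

Lemma max_sw_le s c : 0 <= c -> (forall j, sw sigma s j <= c) -> max_sw s <= c.
Proof. by move=> c0 sc; rewrite /max_sw; elim/big_ind: _ => // x y xc yc; rewrite ge_max xc. Qed.

Lemma admissible_sw j : admissible (n * m) (fun s => sw sigma s j).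
Proof.
have [mS [M bS]] : admissible (n * m) (fun s => \sum_(i < n) ord_stat ((sigma i)^-1%g j) (block i s)).
  by apply: admissible_sum => i; apply: admissible_take_drop (block_lt i) _; exact: admissible_ord_stat.
split; last first.
  exists n%:R => s sN us; have /andP[s0 sn] := sw_bounds j sN us.
  by rewrite ger0_norm.
by apply: eq_seq_measurable mS => s sN; apply: eq_bigr => i _; rewrite utilityE.
Qed.

Lemma admissible_max_sw : admissible (n * m) max_sw.
Proof.
split; first by apply: seq_measurable_bigmax => j; case: (admissible_sw j).
exists n%:R => s sN us; rewrite ger0_norm ?max_sw_ge0 // max_sw_le //.
by move=> j; case/andP: (sw_bounds j sN us).
Qed.

Lemma distortion_bounds s j : size s = (n * m)%N -> unit_seq s ->
  0 <= distortion sigma s j <= 1.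
Proof.
move=> sN us; rewrite /distortion -/(max_sw s).
have /andP[s0 _] := sw_bounds j sN us; have sM := sw_le_max s j.
rewrite mulr_ge0 ?invr_ge0 ?max_sw_ge0 //=.
have [->|M0] := eqVneq (max_sw s) 0; first by rewrite invr0 mulr0 ler01.
by rewrite ler_pdivrMr ?mul1r // lt_neqAle eq_sym M0 max_sw_ge0.
Qed.

Lemma admissible_distortion j : admissible (n * m) (fun s => distortion sigma s j).
Proof.
split.
  apply: seq_measurable_div; first exact: max_sw_ge0.
    by case: (admissible_sw j).
  by case: admissible_max_sw.
by exists 1 => s sN us; have /andP[? ?] := distortion_bounds j sN us; rewrite ger0_norm.
Qed.

(** An alternative keeps its rank for every voter, so its welfare moves by at most the sum of the
    [c i], and the maximum inherits the bound. Both concentration arguments rest on this. *)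
Lemma max_sw_lip s u (c : 'I_n -> R) :
  size s = (n * m)%N -> size u = (n * m)%N -> (forall i, 0 <= c i) ->
  (forall i k, ord_stat k (block i s) <= ord_stat k (block i u) + c i) ->
  max_sw s <= max_sw u + \sum_(i < n) c i.
Proof.
move=> sN uN c0 H; apply: max_sw_le => [|j].
  by rewrite addr_ge0 ?max_sw_ge0 // sumr_ge0.
apply: le_trans (lerD (sw_le_max u j) (lexx _)); rewrite /sw -big_split /=.
by apply: ler_sum => i _; rewrite !utilityE.
Qed.

Let mu := Rintegral D setT (fun x : R => x).

Lemma norm_unit_le1 (x : R) : 0 <= x <= 1 -> `|x| <= 1.
Proof. by case/andP=> x0 x1; rewrite ger0_norm. Qed.

(** Summed over all alternatives, the utilities of a voter are the samples of that voter in another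
    order, whatever the ranking. *)
Lemma exp_sum_sw : \sum_(j < m) exp_sw D sigma j = m%:R * (n%:R * mu).
Proof.
rewrite /exp_sw -(iid_exp_sum D01); last exact: admissible_sw.
have -> : E (n * m) (fun s => \sum_(j < m) sw sigma s j) =
    E (n * m) (fun s => \sum_(i < n) \sum_(x <- block i s) x).
  apply: eq_iid_exp => s sN; rewrite exchange_big; apply: eq_bigr => i _ /=.
  under eq_bigr do rewrite utilityE //.
  rewrite (reindex_inj (@perm_inj _ (sigma i))) /=.
  under eq_bigr do rewrite permK.
  have ps : perm_eq (sort (fun x y : R => y <= x) (block i s)) (block i s).
    by rewrite perm_sort.
  rewrite -(perm_big _ ps) /=.
  by rewrite [RHS](big_nth 0) size_sort size_block // big_mkord.
have aS := admissible_sum_seq m (@measurable_id _ R setT) norm_unit_le1.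
rewrite (iid_exp_sum D01); last by move=> i; exact: admissible_take_drop (block_lt i) aS.
under eq_bigr => i _.
  rewrite (iid_exp_take_drop D (fun s => \sum_(x <- s) x)) ?block_lt //.
  rewrite (iid_exp_sum_seq D01 m (@measurable_id _ R setT) norm_unit_le1).
  over.
by rewrite sumr_const card_ord -[LHS]mulr_natl mulrCA.
Qed.

(** A maximum is at least the average, here n mu. *)
Lemma exp_sw_ewm j : (forall j', exp_sw D sigma j' <= exp_sw D sigma j) ->
  n%:R * mu <= exp_sw D sigma j.
Proof.
move=> mj; have m0 : 0 < m%:R :> R by rewrite ltr0n (leq_ltn_trans _ (ltn_ord j)).
rewrite -(ler_pM2l m0) -exp_sum_sw mulr_natl.
rewrite -[leRHS](_ : \sum_(i < m) exp_sw D sigma j = _); last by rewrite sumr_const card_ord.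
by apply: ler_sum.
Qed.

(* Pointwise, |sw/M - sw/w| = (sw/M) |w - M| / w <= |M - w| / w, where M = max_sw. *)
Lemma exp_dist_approx (d : R) j : let w := E (n * m) max_sw in
  0 < w -> E (n * m) (fun s => `|max_sw s - w|) <= d * w ->
  `|exp_dist D sigma j - exp_sw D sigma j / w| <= d.
Proof.
move=> w w0 Hd; have wN := lt0r_neq0 w0.
have aw : admissible (n * m) (fun s => `|max_sw s - w|).
  by apply/admissible_norm/admissibleB; [exact: admissible_max_sw|exact: admissible_cst].
have pt s : size s = (n * m)%N -> unit_seq s ->
  `|distortion sigma s j - w^-1 * sw sigma s j| <= w^-1 * `|max_sw s - w|.
  move=> sN us; rewrite /distortion -/(max_sw s).
  have /andP[s0 _] := sw_bounds j sN us; have sM := sw_le_max s j.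
  (* If the maximal welfare is 0, the welfare of [j] is squeezed to 0 and the left side vanishes, by
     the convention 0/0 = 0. *)
  have [M0|M0] := eqVneq (max_sw s) 0.
    have -> : sw sigma s j = 0 by apply/eqP; rewrite eq_le s0 andbT -M0.
    by rewrite mul0r mulr0 subrr normr0 mulr_ge0 // invr_ge0 ltW.
  have Mp : 0 < max_sw s by rewrite lt_neqAle eq_sym M0 max_sw_ge0.
  have -> : sw sigma s j / max_sw s - w^-1 * sw sigma s j =
     (sw sigma s j / max_sw s) * (w^-1 * (w - max_sw s)) by field; rewrite M0 wN.
  rewrite normrM [X in _ * X]normrM distrC (ger0_norm (_ : 0 <= w^-1)) ?invr_ge0 ?(ltW w0) //.
  rewrite ler_piMl ?mulr_ge0 ?invr_ge0 ?(ltW w0) //.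
  by rewrite ger0_norm ?ler_pdivrMr ?mul1r // divr_ge0 // ltW.
have ad := admissible_distortion j; have as' := admissibleM (admissible_cst (n * m) w^-1) (admissible_sw j).
have -> : exp_dist D sigma j - exp_sw D sigma j / w =
    E (n * m) (fun s => distortion sigma s j - w^-1 * sw sigma s j).
  rewrite (iid_expB D01) // (iid_expZ D01); last exact: admissible_sw.
  by rewrite [X in _ = _ - X]mulrC.
have ub : E (n * m) (fun s => w^-1 * `|max_sw s - w|) <= d.
  by rewrite (iid_expZ D01) // ler_pdivrMl // mulrC.
have auw := admissibleM (admissible_cst (n * m) w^-1) aw.
rewrite ler_norml; apply/andP; split; last first.
  apply: le_trans ub; apply: (iid_exp_le D01) => // [|s sN us]; first exact: admissibleB.
  by apply: le_trans (pt s sN us); rewrite ler_norm.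
rewrite lerNl -mulN1r -(iid_expZ D01); last exact: admissibleB.
apply: le_trans ub; apply: (iid_exp_le D01) => // [|s sN us].
  by apply: admissibleM; [exact: admissible_cst|exact: admissibleB].
by apply: le_trans (pt s sN us); rewrite mulN1r -normrN ler_norm.
Qed.

(** With e = d / mu, the choice of [f] has expected distortion at least mu - e and is within 2 e of
    the best. The last hypothesis says 2 e <= eps (mu - e), which makes the additive loss a relative
    one. *)
Lemma good_approx_of_concentration (eps d : R) (f : profile n m -> 'I_m) :
  (0 < n)%N -> 0 < mu -> 0 < eps -> 0 <= d -> ewm_rule D f ->
  E (n * m) (fun s => `|max_sw s - E (n * m) max_sw|) <= n%:R * d ->
  d * (2 + eps) <= eps * mu ^+ 2 ->
  good_approx D eps f sigma.
Proof.
move=> n0 mu0 eps0 d0 rf; set w := E _ max_sw => Hd Hmu.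
have n0' : 0 < n%:R :> R by rewrite ltr0n.
have ewm j : exp_sw D sigma j <= exp_sw D sigma (f sigma) := rf sigma j.
have sfn := exp_sw_ewm ewm.
have sfw : exp_sw D sigma (f sigma) <= w.
  by apply: (iid_exp_le D01 (admissible_sw _) admissible_max_sw) => s _ _; exact: sw_le_max.
have w0 : 0 < w by rewrite (lt_le_trans _ (le_trans sfn sfw)) // mulr_gt0.
have wn : w <= n%:R.
  rewrite -(iid_exp_cst D (n * m) n%:R); apply: (iid_exp_le D01) => [||s sN us].
  - exact: admissible_max_sw.
  - exact: admissible_cst.
  by apply: max_sw_le => // j; case/andP: (sw_bounds j sN us).
(* Since w >= n mu, the bound n d is at most (d / mu) w. *)
pose dd := d / mu.
have Hdd : E (n * m) (fun s => `|max_sw s - w|) <= dd * w.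
  apply: le_trans Hd _; rewrite /dd mulrAC ler_pdivlMr // mulrC mulrA mulrC.
  by rewrite [mu * _]mulrC ler_wpM2l // (le_trans sfn).
have H j := exp_dist_approx j w0 Hdd.
(* The numerator is at least n mu and the denominator at most n. *)
have fmu : mu <= exp_sw D sigma (f sigma) / w.
  by rewrite ler_pdivlMr // (le_trans _ sfn) // mulrC ler_wpM2r // ltW.
have dmu : dd * (2 + eps) <= eps * mu.
  by rewrite /dd mulrAC ler_pdivrMr // -mulrA -expr2.
have dd0 : 0 <= dd by rewrite divr_ge0 // ltW.
have := H (f sigma); rewrite ler_norml => /andP[Hf _].
have jf j : exp_dist D sigma j <= exp_dist D sigma (f sigma) + 2 * dd.
  have := H j; rewrite ler_norml => /andP[_ Hj].
  have : exp_sw D sigma j / w <= exp_sw D sigma (f sigma) / w.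
    by rewrite ler_pM2r ?invr_gt0.
  lra.
rewrite /good_approx; set B := \big[_/_]_(_ < _) _.
have B0 : 0 <= B by rewrite /B; elim/big_rec: _ => // j x _ x0; rewrite le_max x0 orbT.
have f0 : 0 <= exp_dist D sigma (f sigma).
  have emu : 2 * dd <= eps * (mu - dd) by lra.
  have : 0 <= mu - dd by rewrite -(pmulr_rge0 _ eps0); lra.
  lra.
have BF : B <= exp_dist D sigma (f sigma) + 2 * dd.
  rewrite /B; elim/big_ind: _ => // [|x y xc yc]; first by lra.
  by rewrite ge_max xc.
have : eps * (mu - dd) <= eps * exp_dist D sigma (f sigma) by rewrite ler_pM2l //; lra.
(* Multiplying [BF] by 1 - eps requires a sign; for eps > 1 the left side of the goal is
   nonpositive. *)
have [e1|e1] := leP eps 1.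
  have := ler_wpM2l (_ : 0 <= 1 - eps) BF; rewrite subr_ge0 => /(_ e1).
  have : 0 <= eps * dd by rewrite mulr_ge0 // ltW.
  nra.
have : 0 <= (eps - 1) * B by rewrite mulr_ge0 // subr_ge0 ltW.
lra.
Qed.

End Welfare.

(** * The degenerate case of mean zero *)

Lemma good_approx_of_null (R : realType) (D : probability R R) (eps : R) n m
  (f : profile n m -> 'I_m) sigma :
  (forall j, exp_dist D sigma j = 0) -> good_approx D eps f sigma.
Proof.
move=> d0; rewrite /good_approx d0; set B := \big[_/_]_(_ < _) _.
suff -> : B = 0 by rewrite mulr0.
by apply: (big_ind (fun x : R => x = 0)) => // x y -> ->; rewrite maxxx.
Qed.

Section Degenerate.
Variables (R : realType) (D : probability R R).
Hypothesis D01 : D `[0, 1]%classic = 1%E.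
Local Notation E := (iid_exp D).

(** The identity is nonnegative on [0, 1], so a zero integral makes it vanish almost everywhere
    there; the complement is null. *)
Lemma ae_eq0_of_mean_eq0 : Rintegral D setT (fun x : R => x) = 0 ->
  {ae D, forall x, x = 0}.
Proof.
have mid : measurable_fun setT (fun x : R => x) by exact: measurable_id.
rewrite (Rintegral_unit_itv D01) // => I0.
have mI : measurable (`[0, 1]%classic : set R) by exact: measurable_itv.
have mE : measurable_fun (`[0, 1]%classic : set R) (EFin : R -> \bar R).
  by apply/measurable_EFinP; exact: measurable_funS mid.
have [H _] := ae_eq_integral_abs D mI mE.
have : (\int[D]_(x in (`[0%R, 1%R]%classic : set R)) `|x%:E| = 0)%E.
  have -> : (\int[D]_(x in (`[0%R, 1%R]%classic : set R)) `|x%:E| =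
      \int[D]_(x in (`[0%R, 1%R]%classic : set R)) x%:E)%E.
    by apply: eq_integral => x; rewrite inE /= in_itv /= => /andP[x0 _]; rewrite ger0_norm.
  rewrite -[LHS]fineK; first by rewrite [X in X%:E]I0.
  have iid : D.-integrable `[0, 1]%classic (EFin \o (fun x : R => x)).
    by apply: (@bounded_integrable R D (fun x : R => x) 1) => // x /andP[x0 x1]; rewrite ger0_norm.
  exact: integrable_fin_num iid.
have D01C : D (~` `[0, 1])%classic = 0%E by rewrite probability_setC // D01 subee.
move=> /H [N [mN N0 HN]].
exists (N `|` ~` `[0, 1])%classic; split.
- by apply: measurableU => //; exact: measurableC.
- by rewrite measureU0 //; exact: measurableC.
move=> x /= xn0; have [x01|x01] := pselect (`[0, 1]%classic x); last by right.
by left; apply: HN => /= /(_ x01) [].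
Qed.

Lemma iid_exp_degenerate N (g : seq R -> R) :
  Rintegral D setT (fun x : R => x) = 0 ->
  seq_measurable N g -> E N g = g (nseq N 0).
Proof.
move=> /ae_eq0_of_mean_eq0 ae0; elim: N g => [//|N IH] g mg.
have mG := seq_measurable1_cons D mg.
rewrite /= -[RHS](iid_exp_cst D 1) /=; congr fine.
apply: ae_eq_integral => //; first exact/measurable_EFinP.
apply: filterS ae0 => x -> _; congr EFin.
by apply: IH; exact: (@seq_measurable_cat _ [:: 0] N g).
Qed.

(** All utilities may be taken to be 0, and 0/0 = 0 makes every expected distortion vanish. *)
Lemma good_approx_degenerate eps n m (f : profile n m -> 'I_m) sigma :
  Rintegral D setT (fun x : R => x) = 0 -> good_approx D eps f sigma.
Proof.
move=> mu0; have d0 j : exp_dist D sigma j = 0.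
  have [md _] := admissible_distortion R sigma j.
  rewrite /exp_dist iid_exp_degenerate // /distortion.
  have -> : sw sigma (nseq (n * m) (0 : R)) j = 0; last by rewrite mul0r.
  rewrite /sw big1 // => i _; rewrite utilityE ?size_nseq // /ord_stat.
  set v := sort _ _; have a0 : all (pred1 0) v.
    by rewrite all_sort; apply/allP => x /mem_take/mem_drop; rewrite mem_nseq => /andP[_].
  have [ks|sk] := ltnP ((sigma i)^-1%g j) (size v).
    by apply/eqP; exact: (all_nthP 0 a0).
  by rewrite nth_default.
exact: good_approx_of_null d0.
Qed.

End Degenerate.

(** * Concentration for many voters, by bounded differences *)

Section ManyVoters.
Variables (R : realType) (D : probability R R) (n m : nat) (sigma : profile n m).
Hypothesis D01 : D `[0, 1]%classic = 1%E.
Local Notation E := (iid_exp D).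

(** As [p] is a whole number of blocks, any block other than the replaced one lies entirely in [p]
    or entirely in [q]. *)
Lemma block_cat_ne (i : nat) (p t t' q : seq R) : (m %| size p)%N ->
  size t = m -> size t' = m -> i <> (size p %/ m)%N -> (0 < m)%N ->
  block m i (p ++ t ++ q) = block m i (p ++ t' ++ q).
Proof.
move=> /dvdnP[a pa] tm t'm; rewrite pa => ia m0; rewrite mulnK // in ia.
rewrite /block.
have [lt_ia|le_ai] := ltnP i a.
  have im : (i * m + m <= size p)%N by rewrite pa addnC -mulSn leq_mul2r lt_ia orbT.
  rewrite !drop_cat (_ : (i * m < size p)%N); last by lia.
  by rewrite !takel_cat // size_drop; lia.
have {ia le_ai}lt_ai : (a < i)%N by rewrite ltn_neqAle le_ai andbT; apply/eqP => ?; apply: ia.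
have im : (size p + m <= i * m)%N by rewrite pa addnC -mulSn leq_mul2r lt_ai orbT.
rewrite !drop_cat ltnNge (leq_trans (leq_addr _ _) im) /= tm t'm.
by rewrite ltnNge leq_subRL ?im // (leq_trans (leq_addr _ _) im).
Qed.

Lemma max_sw_bounded_differences (p t t' q : seq R) : (m %| size p)%N ->
  size t = m -> size t' = m -> size (p ++ t ++ q) = (n * m)%N ->
  unit_seq (p ++ t ++ q) -> unit_seq t' ->
  `|max_sw sigma (p ++ t ++ q) - max_sw sigma (p ++ t' ++ q)| <= 1.
Proof.
move=> mp tm t'm sN us us'.
have sN' : size (p ++ t' ++ q) = (n * m)%N by rewrite -sN !size_cat tm t'm.
have us'' : unit_seq (p ++ t' ++ q).
  by move: us; rewrite !unit_seq_cat us' => /and3P[-> _ ->].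
(* Only the voter owning the replaced block is affected, and order statistics in [0, 1] move by at
   most 1. *)
pose c (i : 'I_n) : R := (nat_of_ord i == size p %/ m)%N%:R.
have c1 : \sum_(i < n) c i <= 1.
  rewrite /c -natr_sum lern1.
  have -> : (\sum_(i < n) (nat_of_ord i == size p %/ m))%N =
      #|[pred i : 'I_n | nat_of_ord i == (size p %/ m)%N]|.
    by rewrite -sum1_card [RHS]big_mkcond; apply: eq_bigr => i _; rewrite inE; case: eqP.
  by apply/card_le1_eqP => i j; rewrite !inE => /eqP ia /eqP ja; apply: val_inj; rewrite /= ia ja.
have key u u' : size u = m -> size u' = m ->
    size (p ++ u ++ q) = (n * m)%N -> size (p ++ u' ++ q) = (n * m)%N ->
    unit_seq (p ++ u ++ q) -> unit_seq (p ++ u' ++ q) ->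
    max_sw sigma (p ++ u ++ q) <= max_sw sigma (p ++ u' ++ q) + 1.
  move=> um u'm sNu sNu' uu uu'.
  apply: le_trans (lerD (lexx _) c1); apply: max_sw_lip => // i k; rewrite /c.
  case: eqP => [_|ia]; last first.
    have [m0|m0] := posnP m; last by rewrite (block_cat_ne q mp um u'm) // addr0.
    by rewrite /block m0 !take0 addr0.
  have /andP[_ l1] := ord_stat_bounds k (unit_block m i uu).
  have /andP[l0 _] := ord_stat_bounds k (unit_block m i uu').
  by rewrite (le_trans l1) // lerDr.
rewrite ler_norml; apply/andP; split.
  by rewrite lerBrDr addrC lerBlDr key.
by rewrite lerBlDl key.
Qed.

(** The variance is at most n, so the mean deviation is at most the square root of n, and this is at
    most n d once n >= 1 / d^2. *)
Lemma max_sw_concentration (d : R) : 0 < d -> (d ^- 2) <= n%:R ->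
  E (n * m) (fun s => `|max_sw sigma s - E (n * m) (max_sw sigma)|) <= n%:R * d.
Proof.
move=> d0 dn; set w := E _ (max_sw sigma).
have aW := admissible_max_sw R sigma; have acw := admissible_cst (n * m) w.
have d2 : 0 < d ^- 2 by rewrite invr_gt0 exprn_gt0.
have n0 : 0 < n%:R :> R by exact: lt_le_trans dn.
have V : E (n * m) (fun s => (max_sw sigma s - w) ^+ 2) <= n%:R.
  by apply: (iid_exp_variance_le D01 aW); exact: max_sw_bounded_differences.
have aV : admissible (n * m) (fun s => (max_sw sigma s - w) ^+ 2).
  exact: admissible_sqr_sub.
(* AM-GM: |x| <= n d / 2 + x^2 / (2 n d) *)
have -> : n%:R * d = n%:R * d / 2 + (n%:R * d / 2) by lra.
apply: (@le_trans _ _ (E (n * m) (fun s => n%:R * d / 2 +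
    (2 * n%:R * d)^-1 * (max_sw sigma s - w) ^+ 2))).
  apply: (iid_exp_le D01) => [||s _ _].
  - exact/admissible_norm/admissibleB.
  - by apply: admissibleD (admissible_cst _ _) _; exact: admissibleM (admissible_cst _ _) _.
  set x := max_sw _ _ - w; rewrite -[x ^+ 2]real_normK ?num_real //.
  have -> : n%:R * d / 2 + (2 * n%:R * d)^-1 * `|x| ^+ 2 =
     `|x| + (2 * n%:R * d)^-1 * (`|x| - n%:R * d) ^+ 2.
    by field; rewrite !lt0r_neq0.
  by rewrite lerDl mulr_ge0 ?sqr_ge0 // invr_ge0 !mulr_ge0 // ltW.
rewrite (iid_expD D01) ?iid_exp_cst ?(iid_expZ D01) //;
  [|exact: admissible_cst|exact: admissibleM (admissible_cst _ _) _].
rewrite lerD2l ler_pdivrMl; last by rewrite !mulr_gt0.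
apply: le_trans V _.
have -> : 2 * n%:R * d * (n%:R * d / 2) = n%:R * (n%:R * d ^+ 2) by field.
rewrite -[leLHS]mulr1 ler_wpM2l ?(ltW n0) //.
by rewrite -ler_pdivrMr ?mul1r // exprn_gt0.
Qed.

End ManyVoters.

(** * Concentration for many alternatives, by empirical tails on a grid *)

Section ManyAlternatives.
Variables (R : realType) (D : probability R R) (L : nat) (gam : R).
Hypothesis D01 : D `[0, 1]%classic = 1%E.
Local Notation E := (iid_exp D).

(** The survival function, written as an integral so that it is literally the mean of one summand of
    [grid_count]. *)
Definition tail (t : R) := Rintegral D setT (fun x => (t < x)%R%:R).

Let grid (i : nat) : R := i%:R / L%:R.

Definition grid_count i (s : seq R) : R := \sum_(x <- s) (grid i < x)%R%:R.

(** Squared errors of the counts in units of m gam / 2: a value below 1 makes every grid point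
    accurate to that precision. It replaces the indicator of a bad sample, and its expectation is a
    sum of variances. *)
Definition deviation m (s : seq R) : R :=
  \sum_(i < L.+1) (2 / (m%:R * gam)) ^+ 2 * (grid_count i s - m%:R * tail (grid i)) ^+ 2.

Hypothesis L0 : (0 < L)%N.
Hypothesis gam0 : 0 < gam.
Hypothesis gap : forall i, (i < L)%N -> gam <= tail (grid i) - tail (grid i.+1).

Lemma deviation_ge0 m s : 0 <= deviation m s.
Proof. by apply: sumr_ge0 => i _; rewrite mulr_ge0 ?sqr_ge0. Qed.

Lemma deviation_lt1 m s i : (0 < m)%N -> (i <= L)%N -> deviation m s < 1 ->
  `|grid_count i s - m%:R * tail (grid i)| < m%:R * gam / 2.
Proof.
move=> m0 iL; rewrite -ltnS in iL; rewrite /deviation (bigD1 (Ordinal iL)) //=.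
set y := grid_count i s - _; set Z := \sum_(_ < _ | _) _ => H.
have Z0 : 0 <= Z by apply: sumr_ge0 => j _; rewrite mulr_ge0 ?sqr_ge0.
have mg : 0 < m%:R * gam by rewrite mulr_gt0 // ltr0n.
have : (2 / (m%:R * gam)) ^+ 2 * y ^+ 2 < 1 by lra.
rewrite -exprMn -[X in X ^+ 2]/(2 / (m%:R * gam) * y) -real_normK ?num_real //.
rewrite -[X in _ < X](expr1n R 2) ltr_pXn2r ?nnegrE // normrM ger0_norm; last first.
  by rewrite divr_ge0 // ltW.
by rewrite mulrAC ltr_pdivrMr // mul1r mulrC ltr_pdivlMr.
Qed.

(* If two order statistics of the same rank differ by more than 2 / L, a whole
   grid cell separates them, which forces one of the two samples to have an
   empirical tail off by at least gam / 2 at an endpoint of that cell. *)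
Lemma ord_stat_deviation m k s u : size s = m -> size u = m ->
  unit_seq s -> unit_seq u ->
  ord_stat k s <= ord_stat k u + (2 / L%:R + deviation m s + deviation m u).
Proof.
move=> sm um us uu; have L0' : 0 < L%:R :> R by rewrite ltr0n.
have ds := deviation_ge0 m s; have du := deviation_ge0 m u.
have iL0 : 0 < 2 / L%:R :> R by rewrite divr_gt0.
have [km|mk] := ltnP k m; last first.
  by rewrite /ord_stat !nth_default ?size_sort ?sm ?um //; lra.
have m0 : (0 < m)%N by exact: leq_ltn_trans km.
rewrite leNgt; apply/negP => H.
have /andP[a0 a1] := ord_stat_bounds k uu; have /andP[b0 b1] := ord_stat_bounds k us.
set a := ord_stat k u in H a0 a1; set b := ord_stat k s in H b0 b1.
(* The first grid point strictly above [a]; the next one is at most a + 2 / L, hence below [b]. *)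
pose i := (Num.truncn (a * L%:R)).+1.
have ai : a < grid i by rewrite /grid ltr_pdivlMr // truncnS_gt.
have ib : grid i.+1 < b.
  apply: le_lt_trans (_ : a + 2 / L%:R < b); last by lra.
  rewrite /grid ler_pdivrMr // mulrDl divfK ?lt0r_neq0 // -[i.+1]addn2 natrD.
  by rewrite lerD2r truncn_le mulr_ge0 // ltW.
have iL : (i < L)%N.
  have : grid i.+1 < 1 by lra.
  by rewrite /grid ltr_pdivrMr // mul1r ltr_nat => /ltnW.
have ks : k%:R <= grid_count i.+1 s.
  rewrite /grid_count -count_sum ler_nat.
  by apply: ltnW; rewrite -ord_stat_gt ?sm.
have ku : grid_count i u <= k%:R.
  rewrite /grid_count -count_sum ler_nat leqNgt -ord_stat_gt ?um //.
  by rewrite -leNgt ltW.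
(* Since b - a <= 1, [H] forces both deviations below 1. Comparing both counts with [k] then gives
   the cell a mass below gam, against [gap]. *)
have := deviation_lt1 m0 iL (_ : deviation m s < 1).
have := deviation_lt1 m0 (ltnW iL) (_ : deviation m u < 1).
rewrite !ltr_norml => /(_ ltac:(lra))/andP[hu _] /(_ ltac:(lra))/andP[_ hs].
have : m%:R * gam <= m%:R * (tail (grid i) - tail (grid i.+1)).
  by rewrite ler_wpM2l // gap.
rewrite mulrBr; lra.
Qed.

Lemma admissible_grid_count N i : admissible N (grid_count i).
Proof.
exact: admissible_sum_seq (measurable_gt_nat _) (fun x _ => normr_bool_le1 R (grid i < x)%R).
Qed.

(** The block variance bound with blocks of one sample, hence the form m * 1: changing a sample
    changes the count by at most 1. *)
Lemma grid_count_variance m i :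
  E m (fun s => (grid_count i s - m%:R * tail (grid i)) ^+ 2) <= m%:R.
Proof.
have ac := admissible_grid_count (m * 1) i.
have Ec : E (m * 1) (grid_count i) = m%:R * tail (grid i).
  rewrite muln1.
  exact: (iid_exp_sum_seq D01 m (measurable_gt_nat _) (fun x _ => normr_bool_le1 R (grid i < x)%R)).
have := iid_exp_variance_le D01 ac; rewrite Ec {2}muln1; apply.
move=> p t t' q _ t1 t'1 _ _ _; rewrite /grid_count !big_cat /=.
case: t t1 => [//|x [|//]] _; case: t' t'1 => [//|y [|//]] _; rewrite !big_seq1.
rewrite [_ - _](_ : _ = (grid i < x)%R%:R - (grid i < y)%R%:R); last by ring.
by case: (grid i < x); case: (grid i < y); rewrite ?subrr ?subr0 ?sub0r ?normrN ?normr1 ?normr0.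
Qed.

Lemma admissible_deviation m : admissible m (deviation m).
Proof.
by apply: admissible_sum => i; apply: admissibleM (admissible_cst _ _) _; apply/admissible_sqr_sub/admissible_grid_count.
Qed.

Lemma iid_exp_deviation_le m : (0 < m)%N ->
  E m (deviation m) <= 4 * L.+1%:R / (m%:R * gam ^+ 2).
Proof.
move=> m0; have m0' : 0 < m%:R :> R by rewrite ltr0n.
have ag i := admissible_sqr_sub (m%:R * tail (grid i)) (admissible_grid_count m i).
rewrite /deviation (iid_exp_sum D01) => [|i]; last exact: admissibleM (admissible_cst _ _) (ag i).
have -> : 4 * L.+1%:R / (m%:R * gam ^+ 2) =
    \sum_(i < L.+1) (2 / (m%:R * gam)) ^+ 2 * m%:R.
  rewrite sumr_const card_ord -mulr_natl; field.
  by rewrite !lt0r_neq0.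
apply: ler_sum => i _; rewrite (iid_expZ D01) //.
by rewrite ler_wpM2l ?sqr_ge0 // grid_count_variance.
Qed.

(** Two samples are compared voter by voter, and one is averaged out. The errors add up over voters,
    so the bound is linear in n and the rate depends on m alone. *)
Lemma max_sw_concentration_alternatives n m (sigma : profile n m) : (0 < m)%N ->
  E (n * m) (fun s => `|max_sw sigma s - E (n * m) (max_sw sigma)|) <=
  n%:R * (2 / L%:R + 8 * L.+1%:R / (m%:R * gam ^+ 2)).
Proof.
move=> m0; pose S s := \sum_(i < n) deviation m (block m i s).
set w := E _ (max_sw sigma).
have aW := admissible_max_sw R sigma.
have aB (i : 'I_n) : admissible (n * m) (fun s => deviation m (block m i s)).
  by apply: admissible_take_drop (block_lt _ i) _; exact: admissible_deviation.
have aS : admissible (n * m) S by exact: admissible_sum.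
have ES : E (n * m) S <= n%:R * (4 * L.+1%:R / (m%:R * gam ^+ 2)).
  rewrite /S (iid_exp_sum D01) // mulr_natl.
  rewrite -[leRHS](_ : \sum_(i < n) 4 * L.+1%:R / (m%:R * gam ^+ 2) = _); last first.
    by rewrite sumr_const card_ord.
  apply: ler_sum => i _; rewrite (iid_exp_take_drop D (deviation m)) ?block_lt //.
  exact: iid_exp_deviation_le.
have pair s u : size s = (n * m)%N -> size u = (n * m)%N -> unit_seq s -> unit_seq u ->
    max_sw sigma s <= max_sw sigma u + (n%:R * (2 / L%:R) + S s + S u).
  move=> sN uN us uu.
  have -> : n%:R * (2 / L%:R) + S s + S u =
      \sum_(i < n) (2 / L%:R + deviation m (block m i s) + deviation m (block m i u)).
    by rewrite !big_split /= sumr_const card_ord mulr_natl.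
  apply: max_sw_lip => // i => [|k].
    by rewrite /= !addr_ge0 ?deviation_ge0 ?divr_ge0 ?ler0n.
  by apply: ord_stat_deviation; rewrite ?size_block // unit_block.
have aC c : admissible (n * m) (fun=> c) by exact: admissible_cst.
(* Averaging [pair] over an independent copy [u] replaces its maximal welfare by [w] and [S u] by
   its mean. Averaging over [s] later adds a second mean of [S], which turns 4 into 8. *)
have one s : size s = (n * m)%N -> unit_seq s ->
    `|max_sw sigma s - w| <= n%:R * (2 / L%:R) + E (n * m) S + S s.
  move=> sN us; set C := n%:R * (2 / L%:R).
  have lower : w <= (max_sw sigma s + C + S s) + E (n * m) S.
    rewrite -(iid_exp_cst D (n * m) (_ + S s)) -(iid_expD D01) //.
    apply: (iid_exp_le D01) => // [|u uN uu]; first exact: admissibleD.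
    by have := pair u s uN sN uu us; rewrite -/C; lra.
  have upper : max_sw sigma s <= w + ((C + S s) + E (n * m) S).
    rewrite -(iid_exp_cst D (n * m) (C + S s)) -(iid_expD D01) // -(iid_expD D01) //.
      rewrite -[leLHS](iid_exp_cst D (n * m)).
      apply: (iid_exp_le D01) => // [|u uN uu]; first by apply: admissibleD => //; exact: admissibleD.
      by have := pair s u sN uN us uu; rewrite -/C; lra.
    exact: admissibleD.
  by rewrite ler_norml; apply/andP; split; lra.
apply: le_trans (_ : E (n * m) (fun s => n%:R * (2 / L%:R) + E (n * m) S + S s) <= _).
  apply: (iid_exp_le D01) => //; first exact/admissible_norm/admissibleB.
  exact: admissibleD.
rewrite (iid_expD D01) // iid_exp_cst.
have -> : n%:R * (2 / L%:R + 8 * L.+1%:R / (m%:R * gam ^+ 2)) =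
  n%:R * (2 / L%:R) + 2 * (n%:R * (4 * L.+1%:R / (m%:R * gam ^+ 2))).
  by field; rewrite !lt0r_neq0 // ltr0n.
lra.
Qed.

End ManyAlternatives.

(** * Positive mass of grid cells, and the choice of thresholds *)

Lemma finite_positive_lower_bound (R : realType) (g : nat -> R) (L : nat) :
  (forall i, (i < L)%N -> 0 < g i) ->
  exists2 gam, 0 < gam & forall i, (i < L)%N -> gam <= g i.
Proof.
elim: L => [|L IH] gp; first by exists 1.
have [i iL|gam gam0 H] := IH; first by rewrite gp // ltnS ltnW.
exists (Num.min gam (g L)) => [|i]; first by rewrite lt_min gam0 gp.
by rewrite ltnS leq_eqVlt => /predU1P[->|iL]; rewrite ge_min ?lexx ?orbT ?H.
Qed.

Lemma tailE (R : realType) (D : probability R R) (t : R) :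
  tail D t = 1 - dist_cdf D t.
Proof.
have mA : measurable (`]t, +oo[%classic : set R) by exact: measurable_itv.
have -> : tail D t = fine (D `]t, +oo[%classic).
  congr fine; transitivity (\int[D]_x (\1_(`]t, +oo[%classic : set R) x)%:E)%E.
    by apply: eq_integral => x _; rewrite indicE mem_setE in_itv /= andbT.
  by rewrite integral_indic // setIT.
by rewrite -setCitvl probability_setC // /dist_cdf fineB // fin_num_measure.
Qed.

(** The mean value theorem uses the derivative only inside the cell, so cells touching 0 or 1 are
    covered too. *)
Lemma tail_decrease (R : realType) (D : probability R R) (F' : R -> R) (a b : R) :
  continuous (dist_cdf D) ->
  (forall x : R, 0 < x < 1 -> is_derive x 1 (dist_cdf D) (F' x)) ->
  (forall x : R, 0 < x < 1 -> 0 < F' x) ->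
  0 <= a -> a < b -> b <= 1 -> 0 < tail D a - tail D b.
Proof.
move=> cF dF F'0 a0 ab b1.
have inab x : x \in `]a, b[ -> 0 < x < 1.
  by rewrite in_itv /= => /andP[ax xb]; rewrite (le_lt_trans a0) //= (lt_le_trans xb).
have [|x xab Fba] := MVT ab (fun x xab => dF x (inab x xab)).
  exact: continuous_subspaceT.
rewrite !tailE [X in 0 < X](_ : _ = dist_cdf D b - dist_cdf D a); last by ring.
by rewrite Fba mulr_gt0 ?subr_gt0 // F'0 // inab.
Qed.

(** The case n = 0 of the second claim, outside the reach of the reduction to concentration: all
    welfares are 0, and 0/0 = 0. *)
Lemma good_approx_no_voters (R : realType) (D : probability R R) (eps : R) m
  (f : profile 0 m -> 'I_m) sigma : good_approx D eps f sigma.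
Proof.
have d0 j : exp_dist D sigma j = 0.
  by rewrite /exp_dist mul0n /= /distortion /sw big_ord0 mul0r.
exact: good_approx_of_null d0.
Qed.

Unset Implicit Arguments.

Theorem theorem3 (R : realType) (D : probability R R) :
  D `[0, 1]%classic = 1%E ->
  (forall eps : R, 0 < eps ->
     exists n0 : nat, forall (n m : nat), (n0 <= n)%N ->
       forall (f : profile n m -> 'I_m), ewm_rule D f ->
       forall sigma : profile n m, good_approx D eps f sigma) /\
  ((exists F' : R -> R,
      continuous (dist_cdf D) /\
      ({within `[0, 1], continuous F'})%classic /\
      (forall x : R, 0 < x < 1 -> is_derive x 1 (dist_cdf D) (F' x)) /\
      (forall x : R, 0 < x < 1 -> 0 < F' x)) ->
   forall eps : R, 0 < eps ->
     exists m0 : nat, forall (n m : nat), (m0 <= m)%N ->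
       forall (f : profile n m -> 'I_m), ewm_rule D f ->
       forall sigma : profile n m, good_approx D eps f sigma).
Proof.
move=> D01; set mu := Rintegral D setT (fun x : R => x).
have [mu0|mu_le0] := ltP 0 mu; last first.
  have mu_eq0 : mu = 0.
    apply/eqP; rewrite eq_le mu_le0 /mu (Rintegral_unit_itv D01) //.
    by apply: Rintegral_ge0 => x; rewrite /= in_itv /= => /andP[].
  by split=> [|_] eps _; exists 0%N => n m _ f _ sigma; exact: good_approx_degenerate.
(* The largest precision that [good_approx_of_concentration] accepts. *)
pose d (eps : R) := eps * mu ^+ 2 / (2 + eps).
have d_gt0 eps : 0 < eps -> 0 < d eps.
  by move=> e0; rewrite divr_gt0 ?mulr_gt0 ?exprn_gt0 // addr_gt0.
have d_eq eps : 0 < eps -> d eps * (2 + eps) <= eps * mu ^+ 2.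
  by move=> e0; rewrite divfK // lt0r_neq0 // addr_gt0.
have nat_above (x : R) : exists2 N : nat, (0 < N)%N & x < N%:R.
  by exists (Num.truncn x).+1 => //; exact: truncnS_gt.
split=> [eps eps0|[F' [cF [_ [dF F'0]]]] eps eps0].
  have [n0 n0_gt0 Hn0] := nat_above (d eps ^- 2).
  exists n0 => n m n0n f rf sigma.
  apply: (good_approx_of_concentration D01 (d := d eps)) => //.
  - exact: leq_trans n0n.
  - exact: ltW (d_gt0 _ _).
  - apply: (max_sw_concentration _ D01) => //; first exact: d_gt0.
    by rewrite (le_trans (ltW Hn0)) // ler_nat.
  - exact: d_eq.
(* [L] makes the grid error 2 / L at most d / 2; then [gam] is fixed, and [m0] makes the sampling
   error at most d / 2. None of them depends on n. *)
have [L L_gt0 HL] := nat_above (4 / d eps).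
have L0 : 0 < L%:R :> R by rewrite ltr0n.
have [i iL|gam gam0 gap] := @finite_positive_lower_bound R
    (fun i => tail D (i%:R / L%:R) - tail D (i.+1%:R / L%:R)) L.
  apply: (tail_decrease cF dF F'0); first by rewrite divr_ge0.
    by rewrite ltr_pM2r ?invr_gt0 // ltr_nat.
  by rewrite ler_pdivrMr // mul1r ler_nat.
have [m0 m0_gt0 Hm0] := nat_above (16 * L.+1%:R / (gam ^+ 2 * d eps)).
have de0 := d_gt0 _ eps0.
exists m0 => n m m0m f rf sigma.
have [n0|n_gt0] := posnP n.
  by subst n; exact: good_approx_no_voters.
have m_gt0 : (0 < m)%N by exact: leq_trans m0m.
have mR : 0 < m%:R :> R by rewrite ltr0n.
apply: (good_approx_of_concentration D01 (d := d eps)) => //; [exact: ltW| |exact: d_eq].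
apply: le_trans (max_sw_concentration_alternatives D01 L_gt0 gam0 gap sigma m_gt0) _.
rewrite ler_wpM2l //.
have h1 : 2 / L%:R <= d eps / 2.
  rewrite ler_pdivrMr //; move: HL; rewrite ltr_pdivrMr //; lra.
have h2 : 8 * L.+1%:R / (m%:R * gam ^+ 2) <= d eps / 2.
  have gd : 0 < gam ^+ 2 * d eps by rewrite mulr_gt0 ?exprn_gt0.
  rewrite ler_pdivrMr ?mulr_gt0 ?exprn_gt0 //.
  have : 16 * L.+1%:R / (gam ^+ 2 * d eps) <= m%:R.
    by rewrite (le_trans (ltW Hm0)) // ler_nat.
  rewrite ler_pdivrMr // mulrCA => H; lra.
lra.
Qed.
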